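(* Let $l\ge 1$ and $n_0,\dots,n_{l+1}\ge 1$ be integers, let $\varphi:\mathbb{R}\to\mathbb{R}$ be continuous and slope-restricted on $[0,\beta]$ with $0<\beta<\infty$, let $b^i\in\mathbb{R}^{n_{i+1}}$ ($i=0,\dots,l$) be arbitrary biases, let $T\in\mathcal{D}_n$ be a fixed matrix with $n=\sum_{i=1}^l n_i$, and let $L_{\mathrm{des}}>0$. Consider training the fully-connected feed-forward neural network with $l$ hidden layers by executing the ADMM scheme (defined in the context) for the problem $$\min_{W,\bar W}\ \mathcal{L}(W)+\mathbf{1}_{M_l}(L_{\mathrm{des}}^2,\bar W)\quad\text{s.t.}\quad W=\bar W .$$ Then at all times during training, i.e. for every iterate $\bar W_{k}$, $k\ge 1$, produced by the Lipschitz update step of the scheme, the neural network $f_{\bar W_k}$ with weights $\bar W_k$ satisfies $$\|f_{\bar W_k}(x)-f_{\bar W_k}(y)\|\le L_{\mathrm{des}}\|x-y\|\qquad\text{for all }x,y\in\mathbb{R}^{n_0},$$ that is, $L_{\mathrm{des}}$ is an upper bound on the Lipschitz constant of the neural network with weights $\bar W_k$.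
   Context: Norms on vectors are Euclidean. A function $\varphi:\mathbb{R}\to\mathbb{R}$ is slope-restricted on $[\alpha,\beta]$ if $\alpha\le\frac{\varphi(x)-\varphi(y)}{x-y}\le\beta$ for all real $x\ne y$. Neural network: for weights $W=(W^0,\dots,W^l)$, $W^i\in\mathbb{R}^{n_{i+1}\times n_i}$, and biases $b^i\in\mathbb{R}^{n_{i+1}}$, the map $f_W:\mathbb{R}^{n_0}\to\mathbb{R}^{n_{l+1}}$ is given by $x^0=x$, $x^{i+1}=\phi_{i+1}(W^ix^i+b^i)$ for $i=0,\dots,l-1$, and $f_W(x)=W^lx^l+b^l$, where $\phi_{i}:\mathbb{R}^{n_i}\to\mathbb{R}^{n_i}$ applies $\varphi$ to each coordinate. The Lipschitz constant of $f_W$ is the smallest $L\ge 0$ with $\|f_W(x)-f_W(y)\|\le L\|x-y\|$ for all $x,y$. $\mathcal{D}_n$ is the set of diagonal matrices in $\mathbb{R}^{n\times n}$ with nonnegative diagonal entries. Matrix $M_l$: for weights $W$, let $A\in\mathbb{R}^{n\times(n_0+n)}$ be the block matrix $A=\begin{bmatrix}W^0&\cdots&0&0\\ \vdots&\ddots&\vdots&\vdots\\ 0&\cdots&W^{l-1}&0\end{bmatrix}$ (block diagonal with blocks $W^0,\dots,W^{l-1}$, followed by a zero block with $n_l$ columns), and $B=\begin{bmatrix}0&I_n\end{bmatrix}\in\mathbb{R}^{n\times(n_0+n)}$. Define the symmetric matrix of size $n_0+n+n_{l+1}$ $$M_l(L^2,W)=\begin{bmatrix}\begin{bmatrix}A\\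 B\end{bmatrix}^\top\begin{bmatrix}0&\beta T\\ \beta T&-2T\end{bmatrix}\begin{bmatrix}A\\ B\end{bmatrix}&0\\ 0&0\end{bmatrix}+\begin{bmatrix}-L^2I&0&0&0\\ 0&0&0&0\\ 0&0&0&{W^l}^\top\\ 0&0&W^l&-I\end{bmatrix},$$ where in the second matrix the block sizes are $n_0$, $n-n_l$, $n_l$, $n_{l+1}$. The indicator function is $\mathbf{1}_{M_l}(L^2,\bar W)=0$ if $M_l(L^2,\bar W)\preceq 0$ (negative semidefinite) and $+\infty$ otherwise. ADMM scheme: $\mathcal{L}(W)$ is a real-valued training loss, $\bar W=(\bar W^0,\dots,\bar W^l)$ and $Y=(Y^0,\dots,Y^l)$ have the same block sizes as $W$, $\rho>0$ is a penalty parameter, and the augmented Lagrangian is $$\mathcal{L}_\rho(W,\bar W,Y)=\mathcal{L}(W)+\mathbf{1}_{M_l}(L_{\mathrm{des}}^2,\bar W)+\sum_{i=0}^l\mathrm{tr}\big((Y^i)^\top(W^i-\bar W^i)\big)+\frac{\rho}{2}\sum_{i=0}^l\|W^i-\bar W^i\|_F^2 .$$ Starting from some $\bar W_0,Y_0$, for $k=0,1,2,\dots$ one iterates (loss update) $W_{k+1}\in\arg\min_W\mathcal{L}_\rho(W,\bar W_k,Y_k)$; (Lipschitz update) $\bar W_{k+1}\in\arg\min_{\bar W}\mathcal{L}_\rho(W_{k+1},\bar W,Y_k)$, i.e. the objective is minimized subject to the constraint $M_l(L_{\mathrm{des}}^2,\bar W)\preceq 0$; (dual update) $Y_{k+1}=Y_k+\rho(W_{k+1}-\bar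 W_{k+1})$. *)

(* Defs.v *)
(* MathComp / MathComp-Analysis *)
From HB Require Import structures.
From mathcomp Require Import all_boot all_order all_algebra.
From mathcomp Require Import all_classical all_reals all_analysis.
Set Implicit Arguments.
Unset Strict Implicit.
Unset Printing Implicit Defensive.
Import Order.TTheory GRing.Theory Num.Theory.
Import numFieldNormedType.Exports.
Local Open Scope classical_set_scope.
Local Open Scope ring_scope.

(* The canonical norm of MathComp-Analysis on matrices is the sup norm, hence
   the two definitions below. *)
Definition enorm (R : realType) (m : nat) (x : 'cV[R]_m) : R :=
  Num.sqrt (\sum_(i < m) x i 0 ^+ 2).

Definition frobenius (R : realType) (m p : nat) (A : 'M[R]_(m, p)) : R :=
  Num.sqrt (\sum_(i < m) \sum_(j < p) A i j ^+ 2).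

Definition slope_restricted (R : realType) (alpha beta : R) (phi : R -> R) :=
  forall x y : R, x != y -> alpha <= (phi x - phi y) / (x - y) <= beta.

(* [n] lists the layer widths n_0, ..., n_{l+1}; its values beyond l+1 are
   never used. *)
Definition weights (R : realType) (n : nat -> nat) (l : nat) :=
  forall i : 'I_l.+1, 'M[R]_(n i.+1, n i).

Definition biases (R : realType) (n : nat -> nat) (l : nat) :=
  forall i : 'I_l.+1, 'cV[R]_(n i.+1).

(* x^i, for 0 <= i <= l *)
Fixpoint layer (R : realType) (n : nat -> nat) (l : nat) (phi : R -> R)
    (b : biases R n l) (W : weights R n l) (x : 'cV[R]_(n 0%N)) (i : nat) :
    (i <= l)%N -> 'cV[R]_(n i) :=
  match i with
  | 0%N => fun _ => x
  | j.+1 => fun lt_jl : (j < l)%N =>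
      map_mx phi (W (Ordinal (leqW lt_jl)) *m layer phi b W x (ltnW lt_jl)
                  + b (Ordinal (leqW lt_jl)))
  end.

Definition network (R : realType) (n : nat -> nat) (l : nat) (phi : R -> R)
    (b : biases R n l) (W : weights R n l) (x : 'cV[R]_(n 0%N)) :
    'cV[R]_(n l.+1) :=
  W ord_max *m layer phi b W x (leqnn l) + b ord_max.

Definition lipschitz_bounds (R : realType) (m p : nat)
    (f : 'cV[R]_m -> 'cV[R]_p) : set R :=
  [set L | 0 <= L /\ forall x y, enorm (f x - f y) <= L * enorm (x - y)].

(* When [lipschitz_bounds f] is nonempty it is closed and bounded below, so the
   infimum is its smallest element; when it is empty, [inf] is 0. *)
Definition lipschitz_constant (R : realType) (m p : nat)
    (f : 'cV[R]_m -> 'cV[R]_p) : R := inf (lipschitz_bounds f).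

Definition nneg_diag (R : realType) (m : nat) (T : 'M[R]_m) : Prop :=
  is_diag_mx T /\ forall i, 0 <= T i i.

Definition neg_semidef (R : realType) (m : nat) (M : 'M[R]_m) : Prop :=
  M^T = M /\ forall x : 'cV[R]_m, (x^T *m M *m x) 0 0 <= 0.

Definition hidden_dim (n : nat -> nat) (l : nat) : nat := \sum_(i < l) n i.+1.

Lemma hidden_dimE (n : nat -> nat) (l : nat) :
  (\sum_(i < l) n i + n l = n 0 + hidden_dim n l)%N.
Proof. by rewrite -(big_ord_recr _ (fun i : 'I_l.+1 => n i)) big_ord_recl. Qed.

(* Reads the columns of [C], grouped as (n_0, ..., n_{l-1}), n_l, as grouped
   n_0, (n_1, ..., n_l); the entries are unchanged. *)
Definition regroup (R : realType) (n : nat -> nat) (l p : nat)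
    (C : 'M[R]_(p, \sum_(i < l) n i + n l)) : 'M[R]_(p, n 0%N + hidden_dim n l) :=
  castmx (erefl p, hidden_dimE n l) C.

(* [conform_mx] only transports W^i along i = j. *)
Definition hidden_weights (R : realType) (n : nat -> nat) (l : nat)
    (W : weights R n l) : 'M[R]_(hidden_dim n l, \sum_(j < l) n j) :=
  \mxblock_(i < l, j < l)
    (if i == j then conform_mx 0 (W (widen_ord (leqnSn l) i)) else 0).

Definition Amx (R : realType) (n : nat -> nat) (l : nat) (W : weights R n l) :
    'M[R]_(hidden_dim n l, n 0%N + hidden_dim n l) :=
  regroup (row_mx (hidden_weights W) 0).

Definition Bmx (R : realType) (n : nat -> nat) (l : nat) :
    'M[R]_(hidden_dim n l, n 0%N + hidden_dim n l) :=
  row_mx 0 1%:M.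

(* The row [0 0 W^l] with column blocks n_0, n_1 + ... + n_{l-1}, n_l. *)
Definition last_row (R : realType) (n : nat -> nat) (l : nat)
    (W : weights R n l) : 'M[R]_(n l.+1, n 0%N + hidden_dim n l) :=
  regroup (row_mx 0 (W ord_max)).

(* M_l(L2, W), with L2 standing for the squared Lipschitz bound. *)
Definition Mmx (R : realType) (n : nat -> nat) (l : nat) (beta : R)
    (T : 'M[R]_(hidden_dim n l)) (L2 : R) (W : weights R n l) :
    'M[R]_(n 0%N + hidden_dim n l + n l.+1) :=
  let AB := col_mx (Amx W) (Bmx R n l) in
  block_mx
    (AB^T *m block_mx 0 (beta *: T) (beta *: T) (- (2 *: T)) *m AB) 0
    0 0
  + block_mx
    (block_mx (- L2%:M) 0 0 0) (last_row W)^T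
    (last_row W) (- 1%:M).

Definition indicator_M (R : realType) (n : nat -> nat) (l : nat) (beta : R)
    (T : 'M[R]_(hidden_dim n l)) (L2 : R) (W : weights R n l) : \bar R :=
  if `[< neg_semidef (Mmx beta T L2 W) >] then 0%E else +oo%E.

Definition aug_lagrangian (R : realType) (n : nat -> nat) (l : nat) (beta : R)
    (T : 'M[R]_(hidden_dim n l)) (Ldes rho : R) (loss : weights R n l -> R)
    (W Wbar Y : weights R n l) : \bar R :=
  ((loss W)%:E + indicator_M beta T (Ldes ^+ 2) Wbar
   + (\sum_(i < l.+1) \tr ((Y i)^T *m (W i - Wbar i)))%:E
   + (rho / 2 * \sum_(i < l.+1) frobenius (W i - Wbar i) ^+ 2)%:E)%E.

Definition argmin (R : realType) (U : Type) (f : U -> \bar R) : set U :=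
  [set u | forall v, (f u <= f v)%E].

(* The first K iterations of the scheme; later values of the sequences are
   arbitrary, so that runs which stop are covered. [W 0] is not constrained: the
   scheme starts from [Wbar 0] and [Y 0]. *)
Definition admm_iterates (R : realType) (n : nat -> nat) (l : nat) (beta : R)
    (T : 'M[R]_(hidden_dim n l)) (Ldes rho : R) (loss : weights R n l -> R)
    (W Wbar Y : nat -> weights R n l) (K : nat) : Prop :=
  let Lrho := aug_lagrangian beta T Ldes rho loss in
  forall k : nat, (k < K)%N ->
    [/\ argmin (fun V => Lrho V (Wbar k) (Y k)) (W k.+1),
        argmin (fun V => Lrho (W k.+1) V (Y k)) (Wbar k.+1)
      & forall i, Y k.+1 i = Y k i + rho *: (W k.+1 i - Wbar k.+1 i)].

(* Main.v *)
(* Since W = 0 satisfies the matrix inequality, the Lipschitz update has a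
   finite minimum, so its minimizer satisfies the inequality too. Given two
   inputs, test M_l(L^2, W) on the vector (u, z), where u stacks the
   differences of the layers 0, ..., l and z is the difference of the outputs.
   The T-part of the form is 2 sum_i T_ii w_i (beta v_i - w_i), with v_i and
   w_i the differences before and after activation; it is nonnegative by slope
   restriction. The rest equals |z|^2 - L^2 |x - y|^2 because
   z = W^l (x^l - y^l). *)
Require Import Defs.
From HB Require Import structures.
From mathcomp Require Import all_boot all_order all_algebra.
From mathcomp Require Import all_classical all_reals all_analysis.
From mathcomp Require Import ring lra.
Set Implicit Arguments.
Unset Strict Implicit.
Unset Printing Implicit Defensive.
Import Order.TTheory GRing.Theory Num.Theory.
Import numFieldNormedType.Exports.
Local Open Scope classical_set_scope.
Local Open Scope ring_scope.

(** * Regrouping stacked block columns *)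

(** Mirror image of [mxcol_recu], splitting off the last block instead of the first. The position of
    an entry in the stack is its offset plus the sizes of the preceding blocks, which gives the same
    number on both sides. *)
Lemma mxcol_recr (T : Type) (p m : nat) (p_ : 'I_p.+1 -> nat)
    (B : forall i, 'M[T]_(p_ i, m))
    (eq_p : (\sum_(i < p) p_ (widen_ord (leqnSn p) i) + p_ ord_max
             = \sum_(i < p.+1) p_ i)%N) :
  \mxcol_i B i =
  castmx (eq_p, erefl)
    (col_mx (\mxcol_i B (widen_ord (leqnSn p) i)) (B ord_max)).
Proof.
apply/mxcolP => k; apply/matrixP => a j; rewrite mxcolK mxE castmxE cast_ord_id.
case: (unliftP ord_max k) a => [i|] -> a; last first.
  suff -> : cast_ord (esym eq_p) (@tagnat.Rank _ p_ _ a) = rshift _ a.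
    by rewrite col_mxEd.
  apply: val_inj; rewrite [LHS]tagnat.RankEsum big_mkcond big_ord_recr /=.
  rewrite ltnn addn0.
  by congr (_ + _)%N; apply: eq_bigr => i _; rewrite ltn_ord.
have eq_i : widen_ord (leqnSn p) i = lift ord_max i.
  by apply: val_inj; rewrite /= /bump leqNgt ltn_ord.
case: _ / eq_i a => a.
have -> : cast_ord (esym eq_p) (@tagnat.Rank _ p_ _ a)
    = lshift _ (@tagnat.Rank _ (fun i => p_ (widen_ord (leqnSn p) i)) i a).
  apply: val_inj; rewrite [LHS]tagnat.RankEsum [RHS]tagnat.RankEsum.
  rewrite big_mkcond big_ord_recr /=.
  by rewrite [(p < i)%N]ltnNge (ltnW (ltn_ord i)) addn0 -big_mkcond.
have /matrixP/(_ a j) := mxcolK (fun i => B (widen_ord (leqnSn p) i)) i.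
by rewrite mxE col_mxEu => ->.
Qed.

Lemma mulmx_cast_inner (R : pzSemiRingType) (m p q r : nat) (eq_pq : p = q)
    (A : 'M[R]_(m, p)) (B : 'M[R]_(p, r)) :
  castmx (erefl m, eq_pq) A *m castmx (eq_pq, erefl r) B = A *m B.
Proof. by case: _ / eq_pq. Qed.

(** Both sides are the full stack of the [d i], cut after its first block or before its last. This
    lets the casts made by [regroup] cancel in products. *)
Lemma col_mxcol_regroup (R : realType) (n : nat -> nat) (l : nat)
    (d : forall i : 'I_l.+1, 'cV[R]_(n i)) :
  col_mx (d ord0) (\mxcol_(i < l) d (lift ord0 i)) =
  castmx (hidden_dimE n l, erefl 1%N)
    (col_mx (\mxcol_(i < l) d (widen_ord (leqnSn l) i)) (d ord_max)).
Proof.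
have eq_r : (\sum_(i < l) n i + n l = \sum_(i < l.+1) n i)%N.
  by rewrite big_ord_recr.
apply: (can_inj (castmxK (@mxsize_recl _ (fun i : 'I_l.+1 => n i)) erefl)).
rewrite -(mxcol_recu d) (mxcol_recr d eq_r) castmx_comp.
exact: eq_castmx.
Qed.

Lemma Amx_col (R : realType) (n : nat -> nat) (l : nat) (W : weights R n l)
    (d : forall i : 'I_l.+1, 'cV[R]_(n i)) :
  Amx W *m col_mx (d ord0) (\mxcol_(i < l) d (lift ord0 i)) =
  \mxcol_(i < l) (W (widen_ord (leqnSn l) i) *m d (widen_ord (leqnSn l) i)).
Proof.
rewrite col_mxcol_regroup /Amx /regroup mulmx_cast_inner mul_row_col.
rewrite mul0mx addr0 /hidden_weights mul_mxblock_mxrow; apply: eq_mxcol => i.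
rewrite (bigD1 i) //= eqxx conform_mx_id big1 ?addr0 // => j.
by rewrite eq_sym => /negPf ->; rewrite mul0mx.
Qed.

Lemma last_row_col (R : realType) (n : nat -> nat) (l : nat)
    (W : weights R n l) (d : forall i : 'I_l.+1, 'cV[R]_(n i)) :
  last_row W *m col_mx (d ord0) (\mxcol_(i < l) d (lift ord0 i)) =
  W ord_max *m d ord_max.
Proof.
rewrite col_mxcol_regroup /last_row /regroup mulmx_cast_inner mul_row_col.
by rewrite mul0mx add0r.
Qed.

Lemma Bmx_col (R : realType) (n : nat -> nat) (l : nat)
    (u : 'cV[R]_(n 0%N)) (w : 'cV[R]_(hidden_dim n l)) :
  Bmx R n l *m col_mx u w = w.
Proof. by rewrite /Bmx mul_row_col mul0mx mul1mx add0r. Qed.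

(** * The quadratic form of [Mmx] *)

Lemma enorm_sqr (R : realType) (m : nat) (x : 'cV[R]_m) :
  enorm x ^+ 2 = (x^T *m x) 0 0.
Proof.
rewrite sqr_sqrtr; last by apply: sumr_ge0 => i _; exact: sqr_ge0.
by rewrite mxE; apply: eq_bigr => i _; rewrite mxE.
Qed.

Lemma is_diag_mx_tr (R : nmodType) (m : nat) (T : 'M[R]_m) :
  is_diag_mx T -> T^T = T.
Proof. by case/diag_mxP => d ->; rewrite tr_diag_mx. Qed.

Lemma diag_bilinear (R : comPzSemiRingType) (m : nat) (T : 'M[R]_m)
    (x y : 'cV[R]_m) :
  is_diag_mx T -> (x^T *m T *m y) 0 0 = \sum_i T i i * (x i 0 * y i 0).
Proof.
case/diag_mxP => d ->; rewrite -mulmxA mul_diag_mx mxE.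
by apply: eq_bigr => i _; rewrite !mxE eqxx mulr1n mulrCA.
Qed.

(** [z] is left free so that the expansion serves both for semidefiniteness at zero weights and for
    the test vector of the Lipschitz estimate. *)
Lemma Mmx_form (R : realType) (n : nat -> nat) (l : nat) (beta : R)
    (T : 'M[R]_(hidden_dim n l)) (L2 : R) (W : weights R n l)
    (u : 'cV[R]_(n 0%N)) (w : 'cV[R]_(hidden_dim n l)) (z : 'cV[R]_(n l.+1)) :
  is_diag_mx T ->
  ((col_mx (col_mx u w) z)^T *m Mmx beta T L2 W *m col_mx (col_mx u w) z) 0 0 =
  2 * (\sum_i T i i * (w i 0 * (beta * (Amx W *m col_mx u w) i 0 - w i 0)))
  - L2 * enorm u ^+ 2
  + 2 * (z^T *m (last_row W *m col_mx u w)) 0 0 - enorm z ^+ 2.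
Proof.
move=> T_diag; rewrite /Mmx.
set v := Amx W *m _; set c := last_row W *m _.
rewrite mulmxDr mulmxDl.
(* Stacking [Amx W] over [Bmx] sends (u, w) to (v, w). *)
have -> : (col_mx (col_mx u w) z)^T *m
    block_mx ((col_mx (Amx W) (Bmx R n l))^T
      *m block_mx 0 (beta *: T) (beta *: T) (- (2 *: T))
      *m col_mx (Amx W) (Bmx R n l)) 0 0 0 *m col_mx (col_mx u w) z =
    (col_mx v w)^T *m block_mx 0 (beta *: T) (beta *: T) (- (2 *: T))
    *m col_mx v w.
  rewrite tr_col_mx mul_row_block !mulmx0 !addr0 mul_row_col mul0mx addr0.
  rewrite -!mulmxA !mul_col_mx Bmx_col !mulmxA -trmx_mul.
  by rewrite mul_col_mx Bmx_col.
rewrite [X in _ + X](_ : _ =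
    - (L2 *: (u^T *m u)) + z^T *m c + c^T *m z - z^T *m z); last first.
  rewrite tr_col_mx mul_row_block mul_row_col !mulmxDl.
  rewrite [in X in X + _ + _]tr_col_mx mul_row_block !mulmx0 !addr0.
  rewrite mul_row_col mul0mx addr0 mulmxN mul_mx_scalar mulNmx -scalemxAl.
  rewrite -mulmxA -/c -trmx_mul -/c mulmxN mulmx1 mulNmx.
  by rewrite !addrA.
(* The two cross terms are transposes of each other and have size 1. *)
have -> : c^T *m z = z^T *m c.
  have tr1 (A : 'M[R]_1) : A^T = A by apply/matrixP => i j; rewrite !ord1 mxE.
  by rewrite -[LHS]tr1 trmx_mul trmxK.
rewrite tr_col_mx mul_row_block mul_row_col !mulmx0 add0r !enorm_sqr.
rewrite mulmxDl mulmxN mulNmx -!scalemxAr -!scalemxAl.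
have entryD (A B : 'M[R]_1) : (A + B) 0 0 = A 0 0 + B 0 0 by rewrite mxE.
have entryN (A : 'M[R]_1) : (- A) 0 0 = - A 0 0 by rewrite mxE.
have entryZ a (A : 'M[R]_1) : (a *: A) 0 0 = a * A 0 0 by rewrite mxE.
rewrite !(entryD, entryN, entryZ) !diag_bilinear //.
have -> : \sum_i T i i * (w i 0 * (beta * v i 0 - w i 0)) =
    beta * \sum_i T i i * (w i 0 * v i 0) - \sum_i T i i * (w i 0 * w i 0).
  by rewrite mulr_sumr -sumrB; apply: eq_bigr => i _; ring.
have -> : \sum_i T i i * (v i 0 * w i 0) = \sum_i T i i * (w i 0 * v i 0).
  by apply: eq_bigr => i _; rewrite (mulrC (v i 0)).
ring.
Qed.

(** * Feasibility of the Lipschitz update *)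

Lemma Mmx_tr (R : realType) (n : nat -> nat) (l : nat) (beta : R)
    (T : 'M[R]_(hidden_dim n l)) (L2 : R) (W : weights R n l) :
  is_diag_mx T -> (Mmx beta T L2 W)^T = Mmx beta T L2 W.
Proof.
move=> /is_diag_mx_tr T_sym; rewrite /Mmx linearD /= !tr_block_mx !trmx0 trmxK.
rewrite !trmx_mul trmxK tr_block_mx !linearN !linearZ /= T_sym trmx0 mulmxA.
by rewrite !tr_scalar_mx.
Qed.

(** Only -2 w^T T w - L^2 |u|^2 - |z|^2 survives. *)
Lemma neg_semidef_Mmx0 (R : realType) (n : nat -> nat) (l : nat) (beta L : R)
    (T : 'M[R]_(hidden_dim n l)) :
  nneg_diag T -> neg_semidef (Mmx beta T (L ^+ 2) ((fun=> 0) : weights R n l)).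
Proof.
move=> [T_diag T_ge0]; split=> [|x]; first exact: Mmx_tr.
rewrite -[x]vsubmxK -[usubmx x]vsubmxK Mmx_form //.
set W0 := ((fun=> 0) : weights R n l).
have -> : Amx W0 = 0.
  rewrite /Amx /regroup.
  have -> : hidden_weights W0 = 0.
    rewrite /hidden_weights -[RHS]mxblock0; apply: eq_mxblock => i j.
    (* On the diagonal, each branch of [conform_mx] gives zero: the default is 0 and so is the
       transported weight. *)
    by case: eqP => // _; rewrite /conform_mx; case: eqP => // ?;
       case: eqP => // ?; rewrite castmx_const.
  by rewrite row_mx0 castmx_const.
have -> : last_row W0 = 0.
  by rewrite /last_row /regroup row_mx0 castmx_const.
rewrite !mul0mx mulmx0 mxE mulr0 addr0 -addrA -opprD subr_le0.
apply: (@le_trans _ _ 0); last first.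
  by apply: addr_ge0; rewrite -?exprMn sqr_ge0.
rewrite mulr_ge0_le0 //; apply: sumr_le0 => i _; rewrite mulr_ge0_le0 // !mxE.
by rewrite mulr0 sub0r mulrN oppr_le0 -expr2 sqr_ge0.
Qed.

Lemma aug_lagrangian_argmin_feasible (R : realType) (n : nat -> nat) (l : nat)
    (beta Ldes rho : R) (T : 'M[R]_(hidden_dim n l))
    (loss : weights R n l -> R) (W Wbar Y : weights R n l) :
  nneg_diag T ->
  argmin (fun V => aug_lagrangian beta T Ldes rho loss W V Y) Wbar ->
  neg_semidef (Mmx beta T (Ldes ^+ 2) Wbar).
Proof.
move=> T_nneg /(_ (fun=> 0)); rewrite /aug_lagrangian /indicator_M.
rewrite (asboolT (neg_semidef_Mmx0 beta Ldes T_nneg)).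
(* For an infeasible [Wbar], minimality against zero weights would put +oo below a finite value. *)
by case: asboolP.
Qed.

(** * Slope restriction and the Lipschitz estimate *)

(** For x != y the product is q (beta - q) (x - y)^2, where the difference quotient q lies in
    [0, beta]. *)
Lemma slope_restricted_sector (R : realType) (beta : R) (phi : R -> R)
    (x y : R) :
  slope_restricted 0 beta phi ->
  0 <= (phi x - phi y) * (beta * (x - y) - (phi x - phi y)).
Proof.
move=> phi_slope; have [->|x_neq_y] := eqVneq x y.
  by rewrite !subrr mul0r.
have /andP[] := phi_slope _ _ x_neq_y.
have : phi x - phi y = (phi x - phi y) / (x - y) * (x - y).
  by rewrite divfK // subr_eq0.
set q := _ / _ => -> q_ge0 q_le.
rewrite -mulrBl mulrACA -expr2 mulr_ge0 ?sqr_ge0 // mulr_ge0 // subr_ge0 //.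
Qed.

(** Arbitrary bound proofs make the recursion usable at ordinals, whose proofs differ from those
    built inside [layer]. *)
Lemma layer_succ (R : realType) (n : nat -> nat) (l : nat) (phi : R -> R)
    (b : biases R n l) (W : weights R n l) (x : 'cV[R]_(n 0%N)) (i : 'I_l)
    (lt_il : (i < l)%N) (le_il : (i <= l)%N) :
  layer phi b W x lt_il =
  map_mx phi (W (widen_ord (leqnSn l) i) *m layer phi b W x le_il
              + b (widen_ord (leqnSn l) i)).
Proof.
case: i lt_il le_il => i lt_i lt_il le_il.
rewrite /widen_ord /= (bool_irrelevance (ltnW lt_il) le_il).
by rewrite (bool_irrelevance (leqW lt_il) (widen_ord_proof _ _)).
Qed.

Lemma network_lipschitz (R : realType) (n : nat -> nat) (l : nat)
    (beta L : R) (phi : R -> R) (b : biases R n l)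
    (T : 'M[R]_(hidden_dim n l)) (W : weights R n l) :
  slope_restricted 0 beta phi -> nneg_diag T -> 0 <= L ->
  neg_semidef (Mmx beta T (L ^+ 2) W) ->
  forall x y,
    enorm (network phi b W x - network phi b W y) <= L * enorm (x - y).
Proof.
move=> phi_slope [T_diag T_ge0] L_ge0 [_ M_le0] x y.
pose lay u (i : 'I_l.+1) : 'cV[R]_(n i) := layer phi b W u (ltn_ord i).
pose d (i : 'I_l.+1) := lay x i - lay y i.
pose w : 'cV_(hidden_dim n l) := \mxcol_(i < l) d (lift ord0 i).
have net_d : network phi b W x - network phi b W y = W ord_max *m d ord_max.
  rewrite /network /d /lay (bool_irrelevance (leqnn l) (ltn_ord (@ord_max l))).
  by rewrite opprD addrACA subrr addr0 mulmxBr.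
(* The last block z = W^l d_l maximizes 2 z^T W^l d_l - |z|^2, whose value there is |z|^2. *)
have := M_le0 (col_mx (col_mx (d ord0) w) (W ord_max *m d ord_max)).
rewrite Mmx_form // last_row_col Amx_col -enorm_sqr -net_d.
set S := \sum_i _ => form_le0.
have S_ge0 : 0 <= S.
  apply: sumr_ge0 => s _; apply: mulr_ge0 => //.
  rewrite /w; do 2!rewrite [mxcol _ s 0]mxE.
  (* The flat index [s] is neuron [j] of hidden layer i + 1; [p u] is the input of its activation.
     The biases cancel in differences. *)
  set i := tagnat.sig1 s; set j := tagnat.sig2 s.
  pose p u := W (widen_ord (leqnSn l) i)
    *m lay u (widen_ord (leqnSn l) i)
    + b (widen_ord (leqnSn l) i).
  have layerS u : lay u (lift ord0 i) = map_mx phi (p u) by exact: layer_succ.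
  have -> : W (widen_ord (leqnSn l) i) *m d (widen_ord (leqnSn l) i)
      = p x - p y.
    by rewrite /p opprD addrACA subrr addr0 mulmxBr.
  have -> : d (lift ord0 i) = map_mx phi (p x) - map_mx phi (p y).
    by rewrite /d !layerS.
  have -> : (p x - p y) j 0 = p x j 0 - p y j 0 by rewrite mxE [X in _ + X]mxE.
  have -> : (map_mx phi (p x) - map_mx phi (p y)) j 0
      = phi (p x j 0) - phi (p y j 0).
    by rewrite mxE [X in _ + X]mxE ![map_mx _ _ _ _]mxE.
  exact: slope_restricted_sector.
(* It suffices to compare squares, and [form_le0] reads 2 S - L^2 |x - y|^2 + |z|^2 <= 0. *)
rewrite -(ler_pXn2r (ltn0Sn 1)) ?nnegrE ?mulr_ge0 ?sqrtr_ge0 // exprMn.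
have d0 : d ord0 = x - y by [].
by move: form_le0; rewrite d0; lra.
Qed.

Theorem theorem6 (R : realType) (l : nat) (n : nat -> nat)
    (l_ge1 : (1 <= l)%N)
    (n_ge1 : forall i : nat, (i <= l.+1)%N -> (1 <= n i)%N)
    (beta : R) (beta_gt0 : 0 < beta)
    (phi : R -> R) (phi_cont : continuous phi)
    (phi_slope : slope_restricted 0 beta phi)
    (b : biases R n l)
    (T : 'M[R]_(hidden_dim n l)) (T_diag : nneg_diag T)
    (Ldes : R) (Ldes_gt0 : 0 < Ldes)
    (rho : R) (rho_gt0 : 0 < rho)
    (loss : weights R n l -> R)
    (W Wbar Y : nat -> weights R n l)
    (K : nat) (admm : admm_iterates beta T Ldes rho loss W Wbar Y K)
    (k : nat) (k_range : (1 <= k <= K)%N) :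
  (forall x y : 'cV[R]_(n 0%N),
      enorm (network phi b (Wbar k) x - network phi b (Wbar k) y)
        <= Ldes * enorm (x - y))
  /\ lipschitz_constant (network phi b (Wbar k)) <= Ldes.
Proof.
(* Iterate [k] comes from step k - 1 of the scheme, hence k >= 1. *)
have k_eq : k = k.-1.+1 by rewrite prednK //; case/andP: k_range.
have [|_ Wbar_argmin _] := admm k.-1.
  by rewrite -k_eq; case/andP: k_range.
rewrite -k_eq in Wbar_argmin.
have Wbar_feasible := aug_lagrangian_argmin_feasible T_diag Wbar_argmin.
have lip := network_lipschitz b phi_slope T_diag (ltW Ldes_gt0) Wbar_feasible.
(* [Ldes] is one of the Lipschitz bounds, and 0 bounds them from below. *)
split=> //; apply: ge_inf; first by exists 0 => L [].
by split=> //; exact: ltW.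
Qed.
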